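(* There is an $\epsilon$-approximate tensor $t$-design on $S^{d-1}$ with $\epsilon^{-2}$ points, and any such design has at least $\epsilon^{-2}-o_{d\to\infty}(1)$ points.
   Context: Let $\mu$ be the Lebesgue measure on the unit sphere $S^{d-1}\subset\mathbb{R}^d$, normalized so that $\mu(S^{d-1})=1$. For $x\in\mathbb{R}^d$, $x^{\otimes t}$ is the $t$-fold tensor power, with entries $(x^{\otimes t})_{\beta_1,\dots,\beta_t}=\prod_{i=1}^t x_{\beta_i}$ for $\beta_1,\dots,\beta_t\in\{1,\dots,d\}$, and $\|\cdot\|_2$ is the Euclidean norm on such tensors. A weighted set of points $(X,w)$, meaning a finite set $X\subset S^{d-1}$ with a probability measure $w\colon X\to\mathbb{R}_{>0}$, is an $\epsilon$-approximate tensor $t$-design if $\left\|\sum_{x\in X}w(x)\,x^{\otimes t}-\int_{S^{d-1}}v^{\otimes t}\,d\mu(v)\right\|_2\le\epsilon$. The notation $o_{d\to\infty}(1)$ denotes a quantity that tends to $0$ as $d\to\infty$.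
   Formalization: The lower bound is stated for even t only (for odd t two antipodal points of weight 1/2 form an exact design); ''ε^{-2} points'' is read as ⌈ε^{-2}⌉ points, and as at most that many when d = 1, since S^0 has only two points; t ≥ 1 is assumed. *)

(* Defs.v *)
From HB Require Import structures.
From mathcomp Require Import all_boot all_order all_algebra.
From mathcomp Require Import finmap.
From mathcomp Require Import all_classical all_reals all_analysis measurable_realfun.

Set Implicit Arguments.
Unset Strict Implicit.
Unset Printing Implicit Defensive.

Import Order.TTheory GRing.Theory Num.Theory.
Import numFieldNormedType.Exports.

Local Open Scope classical_set_scope.
Local Open Scope ring_scope.

(* Points of R^d are d-tuples rather than row vectors because the library
   equips tuples, but not matrices, with the product sigma-algebra. *)
Notation vec R d := (d.-tuple (measurableTypeR R)).

Definition l2norm (R : realType) (I : finType) (f : I -> R) : R :=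
  Num.sqrt (\sum_i f i ^+ 2).

Definition vnorm (R : realType) (d : nat) (x : vec R d) : R :=
  l2norm (fun i : 'I_d => tnth x i : R).

Definition sphere (R : realType) (d : nat) : set (vec R d) :=
  [set x | vnorm x = 1].

Definition normalize (R : realType) (d : nat) (x : vec R d) : vec R d :=
  [tuple (tnth x i : R) / vnorm x | i < d].

Definition punctured_ball (R : realType) (d : nat) : set (vec R d) :=
  [set x | 0 < vnorm x <= 1].

Definition cons_vec (R : realType) (d : nat) (p : measurableTypeR R * vec R d) :
  vec R d.+1 := [tuple of p.1 :: p.2].

Lemma measurable_cons_vec (R : realType) (d : nat) :
  measurable_fun [set: measurableTypeR R * vec R d] (@cons_vec R d).
Proof. exact: measurable_cons. Qed.

Lemma measurable_vnorm (R : realType) (d : nat) :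
  measurable_fun [set: vec R d] (@vnorm R d : vec R d -> measurableTypeR R).
Proof.
apply: (@measurableT_comp _ _ _ _ _ _ (@Num.sqrt R)).
  by apply: continuous_measurable_fun; exact: sqrt_continuous.
apply: measurable_sum => i; apply: measurable_funX; exact: measurable_tnth.
Qed.

Lemma measurable_normalize (R : realType) (d : nat) :
  measurable_fun [set: vec R d] (@normalize R d).
Proof.
apply/measurable_fun_tnthP => i.
rewrite (_ : _ \o _ = fun x : vec R d => (tnth x i : R) * vnorm x `^ (-1)).
  apply: measurable_funM; first exact: measurable_tnth.
  apply: (@measurableT_comp _ _ _ _ _ _ (@powR R ^~ (-1))).
    exact: measurable_powR.
  exact: measurable_vnorm.
by apply/funext => x /=; rewrite tnth_mktuple powR_inv1 ?sqrtr_ge0.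
Qed.

Lemma measurable_punctured_ball (R : realType) (d : nat) :
  measurable (@punctured_ball R d).
Proof.
rewrite (_ : @punctured_ball R d = [set: vec R d] `&` @vnorm R d @^-1` `]0, 1]).
  by apply: (measurable_vnorm measurableT); exact: measurable_itv.
by rewrite setTI; apply/seteqP; split=> x /=; rewrite in_itv.
Qed.

Section lebesgue_cons.
Context (R : realType) (d : nat).
Variable m : {sigma_finite_measure set (vec R d) -> \bar R}.

Definition lebesgue_cons : set (vec R d.+1) -> \bar R :=
  pushforward (@lebesgue_measure R \x m)%E (@cons_vec R d).

Let lebesgue_cons0 : lebesgue_cons set0 = 0%E.
Proof. by rewrite /lebesgue_cons /pushforward preimage_set0 measure0. Qed.

Let lebesgue_cons_ge0 A : (0 <= lebesgue_cons A)%E.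
Proof. by rewrite /lebesgue_cons /pushforward measure_ge0. Qed.

Let lebesgue_cons_sigma_additive : semi_sigma_additive lebesgue_cons.
Proof.
have mf := @measurable_cons_vec R d.
move=> F mF tF mUF; rewrite /lebesgue_cons /pushforward preimage_bigcup.
apply: measure_semi_sigma_additive.
- by move=> n; rewrite -[X in measurable X]setTI; exact: mf.
- apply/trivIsetP => /= i j _ _ ij; rewrite -preimage_setI.
  by move/trivIsetP : tF => /(_ _ _ _ _ ij) ->//; rewrite preimage_set0.
- by rewrite -preimage_bigcup -[X in measurable X]setTI; exact: mf.
Qed.

HB.instance Definition _ := isMeasure.Build _ _ _ lebesgue_cons
  lebesgue_cons0 lebesgue_cons_ge0 lebesgue_cons_sigma_additive.

Let lebesgue_cons_sigma_finite : sigma_finite setT lebesgue_cons.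
Proof.
have /sigma_finiteP[F [TF ndF Foo]] := sigma_finiteT (@lebesgue_measure R).
have /sigma_finiteP[G [TG ndG Goo]] := sigma_finiteT m.
pose g (x : vec R d.+1) : measurableTypeR R * vec R d :=
  (thead x, [tuple of behead x]).
have mg : measurable_fun setT g.
  apply/measurable_fun_pairP; split; first exact: measurable_tnth.
  exact: measurable_behead.
have cK : cancel (@cons_vec R d) g.
  by move=> [a b]; congr pair; exact: val_inj.
exists (fun n => g @^-1` (F n `*` G n)).
  rewrite -preimage_bigcup (_ : \bigcup_n _ = setT) ?preimage_setT//.
  rewrite -setXTT TF TG predeqE => -[x y]; split.
    by move=> [n _ []/= ? ?]; split; exists n.
  move=> [/= [n _ Fnx] [k _ Gky]]; exists (maxn n k) => //; split.
  - by move: x Fnx; exact/subsetPset/ndF/leq_maxl.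
  - by move: y Gky; exact/subsetPset/ndG/leq_maxr.
move=> k; have [? ?] := Foo k; have [? ?] := Goo k; split.
  by rewrite -[X in measurable X]setTI; apply: mg => //; exact: measurableX.
rewrite /lebesgue_cons /pushforward -comp_preimage.
rewrite (_ : g \o _ = id); last by apply/funext => x /=; rewrite cK.
by rewrite preimage_id product_measure1E// lte_mul_pinfty// ge0_fin_numE.
Qed.

HB.instance Definition _ := Measure_isSigmaFinite.Build _ _ _ lebesgue_cons
  lebesgue_cons_sigma_finite.

End lebesgue_cons.

Fixpoint lebesgue_vec (R : realType) (d : nat) :
    {sigma_finite_measure set (vec R d) -> \bar R} :=
  match d with
  | 0 => @dirac _ (vec R 0) [tuple] R
  | d'.+1 => lebesgue_cons (lebesgue_vec R d')
  end.

(* Up to a constant factor, the Lebesgue (surface) measure of A on the sphere is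
   the volume of the part of the unit ball lying on the rays through A. *)
Section cone_measure.
Context (R : realType) (d : nat).

Definition cone_measure (A : set (vec R d)) : \bar R :=
  lebesgue_vec R d (@normalize R d @^-1` A `&` @punctured_ball R d).

Let cone_measure0 : cone_measure set0 = 0%E.
Proof. by rewrite /cone_measure preimage_set0 set0I measure0. Qed.

Let cone_measure_ge0 A : (0 <= cone_measure A)%E.
Proof. by rewrite /cone_measure measure_ge0. Qed.

Let cone_measure_sigma_additive : semi_sigma_additive cone_measure.
Proof.
have mf := @measurable_normalize R d.
have mB := @measurable_punctured_ball R d.
have mI A : measurable A ->
    measurable (@normalize R d @^-1` A `&` @punctured_ball R d).
  by move=> mA; apply: measurableI => //; rewrite -[X in measurable X]setTI;
    exact: mf.
move=> F mF tF mUF; rewrite /cone_measure preimage_bigcup setI_bigcupl.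
apply: measure_semi_sigma_additive.
- by move=> n; exact: mI.
- apply/trivIsetP => /= i j _ _ ij; rewrite setIACA -preimage_setI.
  by move/trivIsetP : tF => /(_ _ _ _ _ ij) ->//; rewrite preimage_set0 set0I.
- by rewrite -setI_bigcupl -preimage_bigcup; exact: mI.
Qed.

HB.instance Definition _ := isMeasure.Build _ _ _ cone_measure
  cone_measure0 cone_measure_ge0 cone_measure_sigma_additive.

End cone_measure.

Lemma measurable_box (R : realType) (d : nat) (I : set (measurableTypeR R)) :
  measurable I -> measurable [set x : vec R d | forall i, I (tnth x i)].
Proof.
move=> mI; rewrite (_ : [set _ | _] = \big[setI/setT]_(i < d)
    ([set: vec R d] `&` (fun x : vec R d => tnth x i) @^-1` I)).
  by apply: bigsetI_measurable => i _; exact: measurable_tnth.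
rewrite -bigcap_seq; apply/seteqP; split => x /= h i; first by move=> _; split.
by have [] := h i (mem_index_enum _).
Qed.

Lemma lebesgue_vec_box (R : realType) (d : nat) (I : set (measurableTypeR R)) :
  measurable I ->
  lebesgue_vec R d [set x | forall i, I (tnth x i)] =
  (@lebesgue_measure R I ^+ d)%E.
Proof.
move=> mI; elim: d => [|d IHd].
  by rewrite /= diracE mem_set//= => -[].
rewrite expeS -IHd -product_measure1E//; last exact: measurable_box.
rewrite /= /lebesgue_cons /pushforward; congr (_ _).
apply/seteqP; split => -[a x] /=.
  move=> h; split; first exact: (h ord0).
  by move=> i; have := h (lift ord0 i); rewrite tnthS.
by move=> [Ia Ix] i; case: (unliftP ord0 i) => [j ->|->]; rewrite ?tnthS ?theadE.
Qed.

Lemma cone_measure_setT_gt0 (R : realType) (d : nat) :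
  (0 < d)%N -> (0 < @cone_measure R d setT)%E.
Proof.
move=> d0; rewrite /cone_measure preimage_setT setTI.
have dR : 0 < (d%:R : R) by rewrite ltr0n.
pose I : set (measurableTypeR R) := `]0, d%:R^-1[%classic.
have mI : measurable I by exact: measurable_itv.
apply: (@lt_le_trans _ _ (lebesgue_vec R d [set x | forall i, I (tnth x i)])).
  rewrite lebesgue_vec_box// lebesgue_measure_itv /= lte_fin invr_gt0 dR.
  by rewrite expe_gt0// sube0 lte_fin invr_gt0.
apply: le_measure; rewrite ?inE.
- exact: measurable_box.
- exact: measurable_punctured_ball.
move=> x /= Ix.
have h i : 0 < (tnth x i : R) /\ (tnth x i : R) < d%:R^-1.
  by have := Ix i; rewrite /I /= in_itv /= => /andP.
rewrite /punctured_ball /= /vnorm /l2norm sqrtr_gt0; apply/andP; split.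
  case: d d0 {dR I mI Ix} x h => // d _ x h.
  rewrite big_ord_recl ltr_pwDl ?exprn_gt0 ?(h _).1//.
  by apply: sumr_ge0 => i _; exact: sqr_ge0.
rewrite -(sqrtr1 R) ler_wsqrtr//.
apply: (@le_trans _ _ (\sum_(i < d) d%:R^-1)).
  apply: ler_sum => i _; have [h1 h2] := h i.
  have d1 : d%:R^-1 <= 1 :> R by rewrite invf_le1// ler1n.
  apply: le_trans (ltW h2); rewrite expr2 ler_piMl ?ltW//.
  exact: lt_le_trans h2 d1.
by rewrite sumr_const card_ord -[leLHS]mulr_natr mulVf// gt_eqF.
Qed.

Lemma cone_measure_setT_lty (R : realType) (d : nat) :
  (@cone_measure R d setT < +oo)%E.
Proof.
rewrite /cone_measure preimage_setT setTI.
pose I : set (measurableTypeR R) := `[-1, 1]%classic.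
have mI : measurable I by exact: measurable_itv.
apply: (@le_lt_trans _ _ (lebesgue_vec R d [set x | forall i, I (tnth x i)])).
  apply: le_measure; rewrite ?inE.
  - exact: measurable_punctured_ball.
  - exact: measurable_box.
  move=> x /= /andP[_ x1] i; rewrite /I /= in_itv /= -ler_norml.
  apply: le_trans x1; rewrite /vnorm /l2norm -sqrtr_sqr ler_wsqrtr//.
  rewrite (bigD1 i)//= lerDl; apply: sumr_ge0 => j _; exact: sqr_ge0.
rewrite lebesgue_vec_box// lebesgue_measure_itv /= lte_fin.
case: ifP => _; last by case: d => *; rewrite ?expe0 ?ltry// expeS mul0e.
by rewrite -EFinB -EFin_expe ltry.
Qed.
(* A measure on R^d carried by the sphere.  The Dirac mass is the default value
   of mnormalize, which by the two lemmas above is not used when 0 < d. *)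
Definition sphere_measure (R : realType) (d : nat) : probability (vec R d) R :=
  mnormalize (@cone_measure R d)
    (@dirac _ (vec R d) [tuple (0 : R) | _ < d] R).

Lemma sphere_measure_sphere (R : realType) (d : nat) :
  (0 < d)%N -> sphere_measure R d (@sphere R d) = 1%E.
Proof.
move=> d0; rewrite /sphere_measure /= /mnormalize.
have c0 := cone_measure_setT_gt0 R d0; have coo := cone_measure_setT_lty R d.
rewrite (gt_eqF c0) (lt_eqF coo) /=.
have -> : cone_measure (@sphere R d) = cone_measure [set: vec R d].
  rewrite /cone_measure; congr (lebesgue_vec R d _).
  apply/seteqP; split => x /= [] // _ /[dup] xB /andP[x0 _]; split => //.
  rewrite /sphere /= /vnorm /l2norm.
  rewrite (eq_bigr (fun i : 'I_d => (vnorm x)^-1 ^+ 2 * (tnth x i : R) ^+ 2)).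
    rewrite -mulr_sumr sqrtrM ?sqr_ge0// sqrtr_sqr ger0_norm ?invr_ge0 ?ltW//.
    by rewrite mulVf// gt_eqF.
  by move=> i _; rewrite tnth_mktuple exprMn mulrC.
by rewrite -[X in (X * _)%E]fineK ?ge0_fin_numE ?ltW// -EFinM divff// gt_eqF// fine_gt0// c0.
Qed.

(* An order-t tensor is the family of its entries T b, b : 'I_t -> 'I_d. *)
Definition tensor (R : realType) (d t : nat) := {ffun 'I_t -> 'I_d} -> R.

Definition tensor_power (R : realType) (d t : nat) (x : vec R d) :
  tensor R d t := fun b => \prod_(i < t) (tnth x (b i) : R).

Definition tensor_mean (R : realType) (d t : nat) : tensor R d t :=
  fun b => \int[sphere_measure R d]_(v in @sphere R d) tensor_power v b.

Definition tensor_moment (R : realType) (d t : nat) (X : {fset vec R d})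
  (w : vec R d -> R) : tensor R d t :=
  fun b => \sum_(x <- X) w x * tensor_power x b.

Definition weighted_set (R : realType) (d : nat) (X : {fset vec R d})
  (w : vec R d -> R) : Prop :=
  [/\ forall x, x \in X -> sphere x,
      forall x, x \in X -> 0 < w x &
      \sum_(x <- X) w x = 1].

Definition approx_tensor_design (R : realType) (d t : nat) (eps : R)
  (X : {fset vec R d}) (w : vec R d -> R) : Prop :=
  weighted_set X w /\
  l2norm (fun b : {ffun 'I_t -> 'I_d} =>
    tensor_moment X w b - tensor_mean R b) <= eps.

(* Main.v *)
From HB Require Import structures.
Require Import Defs.
From mathcomp Require Import all_boot all_order all_algebra.
From mathcomp Require Import finmap perm ring.
From mathcomp Require Import all_classical all_reals all_analysis measurable_realfun.

Import Order.TTheory GRing.Theory Num.Theory.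
Import numFieldNormedType.Exports.

Local Open Scope classical_set_scope.
Local Open Scope ring_scope.

(** Write [M] for the mean tensor and [x^t] for the [t]-th tensor power of [x].
    Both halves rest on [<x^t, y^t> = <x, y>^t], which on the sphere makes
    every [x^t] a unit tensor.

    Existence.  For [N] independent uniform points the expected squared norm of
    the sum of the [x^t - M] is [N (1 - |M|^2) <= N], so the uniform average of
    some [N] points is within [N^(-1/2)] of [M].  This choice is derandomized
    one point at a time ([exists_balanced_points]): given the partial sum [S],
    the linear functional [<S - M, x^t>] of [x^t] is at most its mean
    [<S - M, M>] on a set of positive measure, and any such [x] increases the
    squared norm of the sum by at most [1].  In dimension [d > 1] points have
    measure zero ([sphere_measure_point0]), so [x] can avoid the points
    already chosen and there are exactly [N] of them; in dimension [1]
    repetitions are absorbed in the weights.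

    Lower bound.  For even [t] the numbers [<x, y>^t] are nonnegative, so the
    weighted sum [T] of the [x^t] satisfies
    [|T|^2 >= sum of w(x)^2 >= 1/N] ([tensor_moment_sqr_ge]).  On the other hand
    [<x^t, M>] is the mean of [<x, v>^t], at most that of [<x, v>^2], which is
    [1/d] ([tensor_mean_inner_le]).  Hence [eps^2 >= |T - M|^2 >= 1/N - 2/d],
    that is [N >= 1/(eps^2 + 2/d)], and the right-hand side tends to [eps^-2].

    The value [1/d] comes from the symmetries of the sphere: the measure is
    invariant under signed permutations of the coordinates
    ([sphere_measure_signed_perm]), because Lebesgue measure on [R^d] is
    determined by its values on boxes. *)

(** * Lebesgue measure on boxes and signed permutations *)

Definition box {R : realType} {d : nat} (I : 'I_d -> set (measurableTypeR R)) :
  set (vec R d) := [set x | forall i, I i (tnth x i)].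

Lemma measurable_box_family {R : realType} {d : nat}
    (I : 'I_d -> set (measurableTypeR R)) :
  (forall i, measurable (I i)) -> measurable (box I).
Proof.
move=> mI; rewrite (_ : box I = \big[setI/setT]_(i < d)
    ([set: vec R d] `&` (fun x : vec R d => tnth x i) @^-1` I i)).
  by apply: bigsetI_measurable => i _; exact: measurable_tnth.
rewrite -bigcap_seq; apply/seteqP; split => x /= h i; first by move=> _; split.
by have [] := h i (mem_index_enum _).
Qed.

Lemma lebesgue_vec_box_family {R : realType} {d : nat}
    (I : 'I_d -> set (measurableTypeR R)) :
  (forall i, measurable (I i)) ->
  lebesgue_vec R d (box I) = (\prod_(i < d) @lebesgue_measure R (I i))%E.
Proof.
elim: d I => [|d IHd] I mI.
  by rewrite big_ord0 /= diracE mem_set//= => -[].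
rewrite big_ord_recl -IHd// -product_measure1E//; last first.
  exact: measurable_box_family.
rewrite /= /lebesgue_cons /pushforward; congr (_ _).
apply/seteqP; split => -[a x] /=.
  move=> h; split; first exact: (h ord0).
  by move=> i; have := h (lift ord0 i); rewrite tnthS.
by move=> [Ia Ix] i; case: (unliftP ord0 i) => [j ->|->]; rewrite ?tnthS ?theadE.
Qed.

(** Boxes are stable under intersection, generate the sigma-algebra of
    [R^d], and the bounded ones exhaust the space, so the values on boxes
    determine the measure. *)
Lemma lebesgue_vec_unique {R : realType} {d : nat}
    (m : {measure set (vec R d) -> \bar R}) :
  (forall I, (forall i, measurable (I i)) ->
    m (box I) = (\prod_(i < d) @lebesgue_measure R (I i))%E) ->
  forall A, measurable A -> m A = lebesgue_vec R d A.
Proof.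
move=> mbox A mA; apply/esym.
pose G : set (set (vec R d)) :=
  [set B | exists2 I, (forall i, measurable (I i)) & B = box I].
pose g n : set (vec R d) := box (fun=> `[- n%:R, n%:R]%classic).
apply: (@measure_unique _ R _ G g) => //.
- apply/seteqP; split; last first.
    apply: smallest_sub; first exact: sigma_algebra_measurable.
    by move=> _ [I mI ->]; exact: measurable_box_family.
  apply: smallest_sub; first exact: smallest_sigma_algebra.
  move=> B; rewrite -bigcup_seq => -[i _] [C mC <-].
  apply: sub_sigma_algebra.
  exists (fun k => if k == i then C else setT); first by move=> k; case: ifP.
  rewrite setTI; apply/seteqP; split => [x Cx k|x /(_ i)]; last by rewrite eqxx.
  by case: eqVneq => [->|].
- move=> _ _ [I mI ->] [J mJ ->]; exists (fun i => I i `&` J i).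
    by move=> i; exact: measurableI.
  apply/seteqP; split => [x [Ix Jx] i|x IJx]; first by split.
  by split=> i; case: (IJx i).
- by move=> n; exists (fun=> `[- n%:R, n%:R]%classic).
- apply/seteqP; split => // x _.
  pose s := \sum_(i < d) `|tnth x i : R|.
  (* the l1 norm bounds every coordinate *)
  exists (Num.truncn s).+1 => // i; rewrite /= in_itv /= -ler_norml.
  apply: (@le_trans _ _ s); last exact/ltW/truncnS_gt.
  by rewrite /s (bigD1 i)//= lerDl sumr_ge0.
- move=> _ [I mI ->].
  exact: etrans (lebesgue_vec_box_family I mI) (esym (mbox I mI)).
- move=> n.
  have /= gE : lebesgue_vec R d (g n) =
      (\prod_(i < d) @lebesgue_measure R (`[- n%:R, n%:R]%classic)%R)%E.
    exact: lebesgue_vec_box_family.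
  rewrite [ltLHS]gE lebesgue_measure_itv /= -EFinB.
  by case: ifP => _; rewrite prodEFin ltry.
Qed.

Definition signed_perm {R : realType} {d : nat} (s : 'S_d) (e : 'I_d -> bool)
    (x : vec R d) : vec R d :=
  [tuple (if e i then - (tnth x (s i) : R) else tnth x (s i)) | i < d].

Lemma measurable_signed_perm {R : realType} {d : nat} (s : 'S_d) e :
  measurable_fun setT (@signed_perm R d s e).
Proof.
apply/measurable_fun_tnthP => i.
rewrite (_ : _ \o _ = fun x : vec R d =>
    (if e i then - (tnth x (s i) : R) else tnth x (s i))); last first.
  by apply/funext => x /=; rewrite tnth_mktuple.
by case: (e i); [apply: measurableT_comp => //|]; exact: measurable_tnth.
Qed.

(** The preimage of a box is again a box, whose sides are the given ones,
    permuted and possibly reflected; neither changes the product of the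
    lengths. *)
Lemma lebesgue_vec_signed_perm {R : realType} {d : nat} (s : 'S_d) e
    (A : set (vec R d)) : measurable A ->
  lebesgue_vec R d (signed_perm s e @^-1` A) = lebesgue_vec R d A.
Proof.
move=> mA.
have mf := @measurable_signed_perm R d s e.
pose f : {mfun vec R d >-> vec R d} := HB.pack (@signed_perm R d s e)
  (isMeasurableFun.Build _ _ _ _ _ mf).
apply: (lebesgue_vec_unique (pushforward (lebesgue_vec R d) f)) => // I mI.
pose J k := let i := (s^-1)%g k in
  if e i then (-%R : R -> measurableTypeR R) @^-1` I i else I i.
have mJ k : measurable (J k).
  rewrite /J /=; case: (e _); last exact: mI.
  rewrite -[X in measurable X]setTI.
  exact: (@oppr_measurable R setT measurableT _ (mI _)).
transitivity (lebesgue_vec R d (box J)); last first.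
  rewrite lebesgue_vec_box_family// (reindex_inj (@perm_inj _ s)) /=.
  apply: eq_bigr => i _; rewrite /J /= permK; case: (e i) => //.
  exact: (@lebesgue_measureN R _ (mI i)).
congr (lebesgue_vec R d _); apply/seteqP; split => x h k.
  have := h ((s^-1)%g k); rewrite tnth_mktuple permKV /J /=.
  by case: (e _).
by have := h (s k); rewrite tnth_mktuple /J /= permK; case: (e k).
Qed.

(** * Means over the sphere *)

Lemma vnorm_signed_perm {R : realType} {d : nat} (s : 'S_d) e (x : vec R d) :
  vnorm (signed_perm s e x) = vnorm x.
Proof.
rewrite /vnorm /l2norm [in RHS](reindex_inj (@perm_inj _ s)) /=.
congr (Num.sqrt _); apply: eq_bigr => i _; rewrite tnth_mktuple.
by case: (e i); rewrite ?sqrrN.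
Qed.

Lemma normalize_signed_perm {R : realType} {d : nat} (s : 'S_d) e
    (x : vec R d) :
  normalize (signed_perm s e x) = signed_perm s e (normalize x).
Proof.
apply: eq_from_tnth => i; rewrite !tnth_mktuple vnorm_signed_perm.
by case: (e i); rewrite // mulNr.
Qed.

Lemma sphere_measureE {R : realType} {d : nat} (A : set (vec R d)) :
  (0 < d)%N ->
  sphere_measure R d A =
  (cone_measure A * (fine (@cone_measure R d setT))^-1%:E)%E.
Proof.
move=> d0; rewrite /sphere_measure /= /mnormalize.
rewrite (gt_eqF (cone_measure_setT_gt0 R d0)).
by rewrite (lt_eqF (cone_measure_setT_lty R d)).
Qed.

Lemma measurable_sphere {R : realType} {d : nat} : measurable (@sphere R d).
Proof.
rewrite (_ : @sphere R d = [set: vec R d] `&` @vnorm R d @^-1` [set 1]).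
  by apply: (@measurable_vnorm R d measurableT); exact: measurable_set1.
by rewrite setTI.
Qed.

Lemma sphere_sum_sqr {R : realType} {d : nat} (x : vec R d) :
  sphere x -> \sum_(i < d) (tnth x i : R) ^+ 2 = 1.
Proof.
rewrite /sphere /= /vnorm /l2norm => /(congr1 (fun y => y ^+ 2)).
by rewrite sqr_sqrtr ?expr1n// sumr_ge0// => i _; exact: sqr_ge0.
Qed.

(** Signed permutations preserve the norm, hence commute with the radial
    projection that defines the cone measure. *)
Lemma sphere_measure_signed_perm {R : realType} {d : nat} (s : 'S_d) e
    (A : set (vec R d)) : (0 < d)%N -> measurable A ->
  sphere_measure R d (signed_perm s e @^-1` A) = sphere_measure R d A.
Proof.
move=> d0 mA; rewrite !sphere_measureE//; congr (_ * _)%E.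
rewrite /cone_measure.
rewrite -[in RHS](lebesgue_vec_signed_perm s e (_ `&` _)); last first.
  apply: measurableI; last exact: measurable_punctured_ball.
  rewrite -[X in measurable X]setTI.
  exact: (@measurable_normalize R d measurableT _ mA).
congr (lebesgue_vec R d _); apply/seteqP.
by split => x; rewrite /punctured_ball /= vnorm_signed_perm normalize_signed_perm.
Qed.

Lemma sphere_integrable {R : realType} {d : nat} (K : R) (g : vec R d -> R) :
  measurable_fun setT g -> (forall x, sphere x -> `|g x| <= K) ->
  (sphere_measure R d).-integrable (@sphere R d) (EFin \o g).
Proof.
move=> mg gK; apply: measurable_bounded_integrable.
- exact: measurable_sphere.
- by apply: le_lt_trans (probability_le1 _ measurable_sphere) _; rewrite ltry.
- exact: measurable_funTS.
- exists K; split; first exact: num_real.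
  by move=> M KM x Sx; exact: le_trans (gK x Sx) (ltW KM).
Qed.

Lemma sphere_mean_cst {R : realType} {d : nat} (c : R) : (0 < d)%N ->
  \int[sphere_measure R d]_(v in @sphere R d) c = c.
Proof.
move=> d0; rewrite Rintegral_cst; last exact: measurable_sphere.
by rewrite [X in fine X](sphere_measure_sphere R d0) mulr1.
Qed.

Lemma sphere_mean_signed_perm {R : realType} {d : nat} (s : 'S_d) e (K : R)
    (g : vec R d -> R) : (0 < d)%N ->
  measurable_fun setT g -> (forall x, sphere x -> `|g x| <= K) ->
  \int[sphere_measure R d]_(v in @sphere R d) g (signed_perm s e v) =
  \int[sphere_measure R d]_(v in @sphere R d) g v.
Proof.
move=> d0 mg gK; apply/esym; congr fine.
have mf := @measurable_signed_perm R d s e.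
have fS : signed_perm s e @^-1` @sphere R d = @sphere R d.
  by apply/seteqP; split => x; rewrite /sphere /= vnorm_signed_perm.
have mgE : measurable_fun setT (EFin \o g) by exact/measurable_EFinP.
have ig : (sphere_measure R d).-integrable (signed_perm s e @^-1` @sphere R d)
    ((EFin \o g) \o signed_perm s e).
  rewrite fS; apply: (sphere_integrable K).
    exact: (measurableT_comp mg mf).
  move=> x Sx; apply: gK; rewrite /sphere /= vnorm_signed_perm; exact: Sx.
have := integral_pushforward mf mgE ig measurable_sphere.
rewrite fS => <-.
apply: eq_measure_integral => A mA _; apply/esym.
exact: sphere_measure_signed_perm.
Qed.

Lemma sphere_mean_sum {R : realType} {d : nat} {I : finType} (c : I -> R)
    (g : I -> vec R d -> R) :
  (forall i, (sphere_measure R d).-integrable (@sphere R d) (EFin \o g i)) ->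
  \int[sphere_measure R d]_(v in @sphere R d) (\sum_i c i * g i v) =
  \sum_i c i * \int[sphere_measure R d]_(v in @sphere R d) g i v.
Proof.
move=> ig; rewrite /Rintegral.
under eq_integral do rewrite -sumEFin.
rewrite (@integral_sum _ _ _ (sphere_measure R d) (@sphere R d) measurable_sphere
  I (fun i v => (c i * g i v)%:E)); last first.
  move=> i; exact: (integrableZl measurable_sphere (c i) (ig i)).
have fi i : (\int[sphere_measure R d]_(v in @sphere R d) (g i v)%:E)%E \is a fin_num.
  exact: (integrable_fin_num measurable_sphere (ig i)).
rewrite (eq_bigr (fun i => (c i * fine
    (\int[sphere_measure R d]_(v in @sphere R d) (g i v)%:E)%E)%:E)).
  by rewrite sumEFin.
move=> i _; rewrite EFinM fineK//.
exact: (integralZl measurable_sphere (ig i)).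
Qed.

(** * Second moments and the mean tensor *)

Definition dot {R : realType} {d : nat} (x y : vec R d) : R :=
  \sum_(i < d) (tnth x i : R) * (tnth y i : R).

Lemma sphere_dot {R : realType} {d : nat} (x : vec R d) :
  sphere x -> dot x x = 1.
Proof.
by move=> Sx; rewrite -(sphere_sum_sqr x Sx); apply: eq_bigr => i; rewrite expr2.
Qed.

(** Cauchy-Schwarz for unit vectors, from [2 |ab| <= a^2 + b^2] in each
    coordinate. *)
Lemma sphere_dot_le1 {R : realType} {d : nat} (x y : vec R d) :
  sphere x -> sphere y -> `|dot x y| <= 1.
Proof.
move=> Sx Sy; apply: le_trans (ler_norm_sum _ _ _) _.
apply: (@le_trans _ _ (\sum_(i < d)
    ((tnth x i : R) ^+ 2 + (tnth y i : R) ^+ 2) / 2)).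
  apply: ler_sum => i _; rewrite ler_pdivlMr// normrM.
  rewrite -(real_normK (num_real (tnth x i : R))).
  rewrite -(real_normK (num_real (tnth y i : R))).
  rewrite -subr_ge0 mulr_natr addrAC -sqrrB; exact: sqr_ge0.
by rewrite -mulr_suml big_split /= !sphere_sum_sqr// divff.
Qed.

Lemma sphere_coord_le1 {R : realType} {d : nat} (x : vec R d) (i : 'I_d) :
  sphere x -> `|tnth x i : R| <= 1.
Proof.
move=> Sx; rewrite -(@ler_pXn2r _ 2)// ?nnegrE// expr1n real_normK ?num_real//.
rewrite -(sphere_sum_sqr x Sx) (bigD1 i)//= lerDl sumr_ge0// => j _.
exact: sqr_ge0.
Qed.

Lemma tensor_power_inner {R : realType} {d t : nat} (x y : vec R d) :
  \sum_(b : {ffun 'I_t -> 'I_d}) tensor_power x b * tensor_power y b =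
  dot x y ^+ t.
Proof.
rewrite -[in RHS](card_ord t) -prodr_const bigA_distr_bigA /=.
by apply: eq_bigr => b _; rewrite /tensor_power -big_split.
Qed.

Lemma sphere_sum_tensor_power_sqr {R : realType} {d t : nat} (x : vec R d) :
  sphere x -> \sum_(b : {ffun 'I_t -> 'I_d}) tensor_power x b ^+ 2 = 1.
Proof.
move=> Sx; under eq_bigr do rewrite expr2.
by rewrite tensor_power_inner sphere_dot// expr1n.
Qed.

Lemma measurable_tensor_power {R : realType} {d t : nat} b :
  measurable_fun setT (fun x : vec R d => @tensor_power R d t x b).
Proof.
rewrite /tensor_power; apply: measurable_prod => i _; exact: measurable_tnth.
Qed.

Lemma tensor_power_le1 {R : realType} {d t : nat} (x : vec R d) b :
  sphere x -> `|@tensor_power R d t x b| <= 1.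
Proof.
move=> Sx; rewrite /tensor_power normr_prod; apply: prodr_ile1 => i _.
by rewrite normr_ge0 sphere_coord_le1.
Qed.

Lemma integrable_tensor_power {R : realType} {d t : nat} b :
  (sphere_measure R d).-integrable (@sphere R d)
    (EFin \o (fun x => @tensor_power R d t x b)).
Proof.
apply: (sphere_integrable 1); first exact: measurable_tensor_power.
by move=> x; exact: tensor_power_le1.
Qed.

(** Reflecting the coordinate [i] changes the sign of [v_i v_j] when
    [i != j], so its mean vanishes.  Exchanging coordinates shows that all
    [v_i^2] have the same mean, and the sum of these [d] means is [1]. *)
Lemma sphere_mean_coordM {R : realType} {d : nat} (i j : 'I_d) :
  \int[sphere_measure R d]_(v in @sphere R d) ((tnth v i : R) * (tnth v j : R))
  = (i == j)%:R / d%:R.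
Proof.
have d0 : (0 < d)%N by exact: leq_ltn_trans (leq0n i) (ltn_ord i).
pose g k l (v : vec R d) := (tnth v k : R) * (tnth v l : R).
have mg k l : measurable_fun setT (g k l).
  by apply: measurable_funM; exact: measurable_tnth.
have g1 k l x : sphere x -> `|g k l x| <= 1.
  by move=> Sx; rewrite /g normrM mulr_ile1// sphere_coord_le1.
have ig k l := sphere_integrable 1 _ (mg k l) (g1 k l).
case: (eqVneq i j) => [<-|ij]; last first.
  have := sphere_mean_signed_perm 1%g (pred1 i) 1 _ d0 (mg i j) (g1 i j).
  rewrite (@eq_Rintegral _ _ _ _ _ (fun v => -1 * g i j v)); last first.
    move=> v _; rewrite /g !tnth_mktuple /= eqxx eq_sym (negbTE ij) !perm1.
    by rewrite mulN1r mulNr.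
  rewrite (@RintegralZl _ _ _ _ _ _ (-1) measurable_sphere (ig i j)) mulN1r => /eqP.
  by rewrite mul0r eqNr => /eqP.
have gi k : \int[sphere_measure R d]_(v in @sphere R d) g k k v =
            \int[sphere_measure R d]_(v in @sphere R d) g i i v.
  rewrite -(sphere_mean_signed_perm (tperm k i) xpred0 1 _ d0 (mg k k) (g1 k k)).
  by apply: eq_Rintegral => v _; rewrite /g !tnth_mktuple /= tpermL.
have : \sum_(k < d) 1 * \int[sphere_measure R d]_(v in @sphere R d) g k k v = 1.
  rewrite -sphere_mean_sum// -[RHS](@sphere_mean_cst R d 1 d0).
  apply: eq_Rintegral => v /set_mem Sv; rewrite -[RHS](sphere_sum_sqr v Sv).
  by apply: eq_bigr => k _; rewrite mul1r expr2.
under eq_bigr do rewrite mul1r gi.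
rewrite sumr_const card_ord => h.
have dn0 : (d%:R : R) != 0 by rewrite pnatr_eq0 -lt0n.
by apply: (mulIf dn0); rewrite mulr_natr divfK.
Qed.

(** The left-hand side is the mean of [<x, v>^t].  As [<x, v>^2] lies between
    [0] and [1], it bounds its powers [<x, v>^t], and its own mean is computed
    from the second moments. *)
Lemma tensor_mean_inner_le {R : realType} {d t : nat} (x : vec R d) :
  sphere x -> ~~ odd t -> (0 < t)%N ->
  \sum_(b : {ffun 'I_t -> 'I_d}) tensor_power x b * tensor_mean R b <= d%:R^-1.
Proof.
move=> Sx t2 t0.
rewrite /tensor_mean -sphere_mean_sum; last first.
  by move=> b; exact: integrable_tensor_power.
under eq_Rintegral do rewrite tensor_power_inner.
pose g (k : 'I_d * 'I_d) (v : vec R d) := (tnth v k.1 : R) * (tnth v k.2 : R).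
have mdot : measurable_fun setT (fun v : vec R d => dot x v).
  apply: measurable_sum => i; apply: measurable_funM => //.
  exact: measurable_tnth.
have idot n : (sphere_measure R d).-integrable (@sphere R d)
    (EFin \o (fun v => dot x v ^+ n)).
  apply: (sphere_integrable 1); first exact: measurable_funX.
  by move=> v Sv; rewrite normrX exprn_ile1// sphere_dot_le1.
have ig k : (sphere_measure R d).-integrable (@sphere R d) (EFin \o g k).
  apply: (sphere_integrable 1).
    by apply: measurable_funM; exact: measurable_tnth.
  by move=> v Sv; rewrite /g normrM mulr_ile1// sphere_coord_le1.
apply: (@le_trans _ _
    (\int[sphere_measure R d]_(v in @sphere R d) dot x v ^+ 2)).
  apply: le_Rintegral => //; first exact: measurable_sphere.
  move=> v Sv; rewrite -(odd_double_half t) (negbTE t2) add0n -muln2 mulnC exprM.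
  have h : (0 < t./2)%N by rewrite half_gt0; case: t t0 t2 => [|[]].
  rewrite -[leRHS]expr1 ler_wiXn2l//; first exact: sqr_ge0.
  rewrite -[X in X <= _](@real_normK _ (dot x v)) ?num_real//.
  by rewrite exprn_ile1// sphere_dot_le1.
have -> : (fun v => dot x v ^+ 2) = (fun v => \sum_(k : 'I_d * 'I_d)
    ((tnth x k.1 : R) * (tnth x k.2 : R)) * g k v).
  apply/funext => v; rewrite expr2 /dot big_distrlr /=.
  by rewrite pair_bigA /=; apply: eq_bigr => k _; rewrite mulrACA.
rewrite sphere_mean_sum//.
under eq_bigr do rewrite sphere_mean_coordM.
rewrite -(pair_bigA _ (fun i j => (tnth x i : R) * (tnth x j : R) *
  ((i == j)%:R / d%:R))) /=.
rewrite (eq_bigr (fun i => (tnth x i : R) ^+ 2 * d%:R^-1)).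
  by rewrite -mulr_suml sphere_sum_sqr// mul1r.
move=> i _; rewrite (bigD1 i)//= eqxx mul1r -expr2 big1 ?addr0// => j ji.
by rewrite eq_sym (negbTE ji) mul0r mulr0.
Qed.

(** * The lower bound *)

(** The difference of the two sides is the sum of the squares of
    [w x - 1/N], with [N] the size of [s]. *)
Lemma sum_sqr_weights_ge {R : realType} {T : eqType} (s : seq T) (w : T -> R) :
  \sum_(x <- s) w x = 1 -> (size s)%:R^-1 <= \sum_(x <- s) w x ^+ 2.
Proof.
move=> w1.
have s0 : ((size s)%:R : R) != 0.
  rewrite pnatr_eq0 size_eq0; apply/eqP => s0; move: w1.
  by rewrite s0 big_nil => /esym/eqP; rewrite oner_eq0.
rewrite -subr_ge0.
rewrite (_ : _ - _ = \sum_(x <- s) (w x - (size s)%:R^-1) ^+ 2).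
  by apply: sumr_ge0 => x _; exact: sqr_ge0.
under [RHS]eq_bigr do rewrite sqrrB -mulr_natl mulrA.
rewrite !big_split /= sumrN -mulr_suml -mulr_sumr w1 mulr1.
have -> : \sum_(i <- s) ((size s)%:R^-1 : R) ^+ 2 = (size s)%:R^-1.
  by rewrite big_const_seq count_predT iter_addr_0 -[LHS]mulr_natr expr2 mulfVK.
by rewrite mulr_natl mulr2n opprD addrA subrK.
Qed.

Lemma tensor_moment_sqr {R : realType} {d t : nat} (X : {fset vec R d}) w :
  \sum_(b : {ffun 'I_t -> 'I_d}) tensor_moment X w b ^+ 2 =
  \sum_(x <- X) \sum_(y <- X) w x * w y * dot x y ^+ t.
Proof.
under eq_bigr do rewrite expr2 /tensor_moment big_distrlr /=.
rewrite exchange_big; apply: eq_bigr => x _; rewrite exchange_big.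
apply: eq_bigr => y _; rewrite -tensor_power_inner mulr_sumr.
by apply: eq_bigr => b _; rewrite mulrACA.
Qed.

(** In the double sum of [w x * w y * <x, y>^t] every term is nonnegative
    because [t] is even; the diagonal terms alone give the bound. *)
Lemma tensor_moment_sqr_ge {R : realType} {d t : nat} (X : {fset vec R d}) w :
  ~~ odd t -> weighted_set X w ->
  (#|` X|)%:R^-1 <= \sum_(b : {ffun 'I_t -> 'I_d}) tensor_moment X w b ^+ 2.
Proof.
move=> t2 [XS w0 w1]; apply: le_trans (sum_sqr_weights_ge _ _ w1) _.
rewrite tensor_moment_sqr big_seq [leRHS]big_seq; apply: ler_sum => x xX.
rewrite (bigD1_seq x)//= -expr2 sphere_dot; last exact: XS.
rewrite expr1n mulr1 lerDl big_seq_cond; apply: sumr_ge0 => y /andP[yX _].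
by rewrite !mulr_ge0 ?exprn_even_ge0 ?ltW// w0.
Qed.

Lemma tensor_moment_inner {R : realType} {d t : nat} (X : {fset vec R d}) w
    (T : tensor R d t) :
  \sum_(b : {ffun 'I_t -> 'I_d}) tensor_moment X w b * T b =
  \sum_(x <- X) w x * \sum_(b : {ffun 'I_t -> 'I_d}) tensor_power x b * T b.
Proof.
under eq_bigr do rewrite mulr_suml.
rewrite exchange_big; apply: eq_bigr => x _; rewrite mulr_sumr.
by apply: eq_bigr => b _; rewrite mulrA.
Qed.

(** Expanding the square, [|T - M|^2 = |T|^2 - 2 <T, M> + |M|^2] is at least
    [1/N - 2/d]: the cross term is an average of the [<x^t, M> <= 1/d]. *)
Lemma design_card_ge {R : realType} {d t : nat} (eps : R)
    (X : {fset vec R d}) w :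
  (0 < d)%N -> (0 < t)%N -> ~~ odd t -> 0 < eps ->
  approx_tensor_design t eps X w ->
  (eps ^+ 2 + 2 / d%:R)^-1 <= (#|` X|)%:R.
Proof.
move=> d0 t0 t2 eps0 [Xw Xeps]; have [XS w0 w1] := Xw.
have N0 : 0 < (#|` X|)%:R :> R.
  rewrite ltr0n lt0n cardfs_eq0; apply/eqP => X0; move: w1.
  by rewrite X0 big_nil => /esym/eqP; rewrite oner_eq0.
have E0 : 0 < eps ^+ 2 + 2 / d%:R :> R.
  by rewrite ltr_wpDr ?exprn_gt0// divr_ge0.
rewrite invf_ple ?posrE//.
apply: le_trans (tensor_moment_sqr_ge X w t2 Xw) _.
have mX : \sum_(b : {ffun 'I_t -> 'I_d}) tensor_moment X w b * tensor_mean R b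
    <= d%:R^-1.
  apply: (@le_trans _ _ ((\sum_(x <- X) w x) * d%:R^-1));
    last by rewrite w1 mul1r.
  rewrite tensor_moment_inner mulr_suml.
  rewrite big_seq [leRHS]big_seq; apply: ler_sum => x xX.
  apply: ler_wpM2l; first exact/ltW/w0.
  exact: (tensor_mean_inner_le x (XS x xX) t2 t0).
have Xeps2 : \sum_(b : {ffun 'I_t -> 'I_d})
    (tensor_moment X w b - tensor_mean R b) ^+ 2 <= eps ^+ 2.
  rewrite -[leLHS]sqr_sqrtr; last by apply: sumr_ge0 => b _; exact: sqr_ge0.
  by apply: lerXn2r => //; rewrite nnegrE ?sqrtr_ge0 ?ltW.
rewrite -lerBlDr; apply: le_trans Xeps2.
under [leRHS]eq_bigr do rewrite sqrrB -mulr_natl.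
rewrite !big_split /= sumrN -mulr_sumr -addrA lerD2l.
apply: ler_wpDr; first by apply: sumr_ge0 => b _; exact: sqr_ge0.
by rewrite lerN2 ler_pM2l.
Qed.

(** * Points are null, and points below the mean exist *)

Lemma lebesgue_vec_coord0 {R : realType} {d : nat} (i : 'I_d) (a : R) :
  lebesgue_vec R d [set x | tnth x i = a] = 0%E.
Proof.
pose I (k : 'I_d) : set (measurableTypeR R) := if k == i then [set a] else setT.
have mI k : measurable (I k) by rewrite /I; case: ifP.
rewrite (_ : [set x | _] = box I).
  by rewrite lebesgue_vec_box_family// (bigD1 i)//= /I eqxx
    lebesgue_measure_set1 mul0e.
apply/seteqP; split => [x /= xi k|x /(_ i)]; last by rewrite /I eqxx.
by rewrite /I; case: eqVneq => [->|].
Qed.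

Lemma measurable_vec_set1 {R : realType} {d : nat} (p : vec R d) : measurable [set p].
Proof.
rewrite (_ : [set p] = box (fun i => [set tnth p i])).
  by apply: measurable_box_family => i; exact: measurable_set1.
apply/seteqP; split => [x -> i //|x h]; apply: eq_from_tnth => i; exact: h.
Qed.

(** Slicing along the first coordinate, each slice fixes the value of the
    second one, hence is null. *)
Lemma lebesgue_vec_hyperplane0 {R : realType} {d : nat} (b c : R) : c != 0 ->
  lebesgue_vec R d.+2
    [set x | (tnth x (lift ord0 ord0) : R) * c = b * tnth x ord0] = 0%E.
Proof.
move=> c0; rewrite /= /lebesgue_cons /pushforward.
apply: integral0_eq => a _ /=.
rewrite -[RHS](@lebesgue_vec_coord0 R d.+1 ord0 (b * a / c)).
have cons0 (y : vec R d.+1) : tnth (cons_vec (a, y)) ord0 = a by [].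
congr (lebesgue_vec R d.+1 _); apply/seteqP; split => y.
  rewrite /xsection /= inE /= tnthS cons0 => h.
  by rewrite -h mulfK.
rewrite /xsection /= inE /= tnthS cons0 => ->.
by rewrite divfK.
Qed.

(** The cone over [p] is contained in the line through [p], and in dimension
    at least two this line lies in a null hyperplane.  The hyperplane
    [x_1 p_0 = p_1 x_0] works unless [p_0 = 0], in which case [x_0 = 0]
    does. *)
Lemma sphere_measure_point0 {R : realType} {d : nat} (p : vec R d) :
  (1 < d)%N -> sphere_measure R d [set p] = 0%E.
Proof.
case: d p => [|[|d]] // p _.
rewrite sphere_measureE// /cone_measure.
set C := _ `&` _.
have mC : measurable C.
  apply: measurableI; last exact: measurable_punctured_ball.
  rewrite -[X in measurable X]setTI.
  by apply: (@measurable_normalize R d.+2 measurableT); exact: measurable_vec_set1.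
suff -> : lebesgue_vec R d.+2 C = 0%E by rewrite mul0e.
have Cp i x : C x -> (tnth x i : R) = tnth p i * vnorm x /\ 0 < vnorm x.
  move=> [/= <- /andP[x0 _]]; split => //.
  by rewrite tnth_mktuple divfK// gt_eqF.
have mt i : measurable_fun setT (fun x : vec R d.+2 => (tnth x i : R)).
  exact: measurable_tnth.
have [p0|p0] := eqVneq (tnth p ord0 : R) 0.
  apply: (@subset_measure0 _ _ _ _ _ [set x : vec R d.+2 | tnth x ord0 = 0]) => //.
  - rewrite -[X in measurable X]setTI.
    by apply: (mt ord0 measurableT [set 0]); exact: measurable_set1.
  - by move=> x /(Cp ord0)[/= -> _]; rewrite p0 mul0r.
  - exact: lebesgue_vec_coord0.
apply: (@subset_measure0 _ _ _ _ _ [set x : vec R d.+2 |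
    (tnth x (lift ord0 ord0) : R) * tnth p ord0
    = tnth p (lift ord0 ord0) * tnth x ord0]) => //.
- rewrite -[X in measurable X]setTI.
  rewrite (_ : [set x | _] = (fun x : vec R d.+2 =>
    (tnth x (lift ord0 ord0) : R) * tnth p ord0
    - tnth p (lift ord0 ord0) * tnth x ord0) @^-1` [set 0]).
    apply: (measurable_funB (measurable_funM (mt _) (measurable_cst _))
      (measurable_funM (measurable_cst _) (mt _)) measurableT).
    exact: measurable_set1.
  apply/seteqP; split => x /=; first by move=> ->; rewrite subrr.
  by move=> /eqP; rewrite subr_eq0 => /eqP.
- by move=> x Cx /=; rewrite !(Cp _ x Cx).1 mulrAC mulrA.
- exact: lebesgue_vec_hyperplane0.
Qed.

Lemma set_seq_cons {T : eqType} (p : T) (s : seq T) :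
  [set` p :: s] = [set p] `|` [set` s].
Proof.
by apply/seteqP; split => x /=; rewrite inE => /predU1P.
Qed.

Lemma measurable_seq {R : realType} {d : nat} (s : seq (vec R d)) :
  measurable [set` s].
Proof.
elim: s => [|p s IH]; first by rewrite set_nil.
by rewrite set_seq_cons; apply: measurableU => //; exact: measurable_vec_set1.
Qed.

Lemma sphere_measure_seq0 {R : realType} {d : nat} (s : seq (vec R d)) :
  (1 < d)%N -> sphere_measure R d [set` s] = 0%E.
Proof.
move=> d1; elim: s => [|p s IH]; first by rewrite set_nil measure0.
rewrite set_seq_cons measureU0//; first exact: sphere_measure_point0.
  exact: measurable_vec_set1.
exact: measurable_seq.
Qed.

(** Otherwise [g] minus its mean would be positive almost everywhere on the
    sphere while its integral vanishes. *)
Lemma exists_le_sphere_mean {R : realType} {d : nat} (s : seq (vec R d))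
    (g : vec R d -> R) : (0 < d)%N ->
  (sphere_measure R d).-integrable (@sphere R d) (EFin \o g) ->
  sphere_measure R d [set` s] = 0%E ->
  exists x, [/\ sphere x, x \notin s &
    g x <= \int[sphere_measure R d]_(v in @sphere R d) g v].
Proof.
move=> d0 ig s0; apply/not_existsP => h.
set m := \int[_]_(v in _) g v in h.
pose D := @sphere R d `\` [set` s].
have mD : measurable D.
  by apply: measurableD; [exact: measurable_sphere|exact: measurable_seq].
have gD x : D x -> m < g x.
  move=> [Sx sx]; rewrite ltNge; apply/negP => gx; apply: (h x); split => //.
  exact/negP.
pose f v := g v - m.
have im : (sphere_measure R d).-integrable (@sphere R d) (EFin \o (fun=> m)).
  by apply: (sphere_integrable `|m|) => //; exact: measurable_cst.
have If : (sphere_measure R d).-integrable (@sphere R d) (EFin \o f).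
  exact: (integrableB measurable_sphere ig im).
have f0 : (\int[sphere_measure R d]_(v in D) (f v)%:E = 0)%E.
  rewrite /D -(negligible_integral (measurable_seq s) measurable_sphere If s0).
  rewrite -[LHS]fineK; last exact: (integrable_fin_num measurable_sphere If).
  apply: (congr1 EFin); apply: etrans (RintegralB measurable_sphere ig im) _.
  by rewrite sphere_mean_cst// subrr.
have fD : (\int[sphere_measure R d]_(v in D) `|(f v)%:E| = 0)%E.
  rewrite -[RHS]f0; apply: eq_integral => v /set_mem Dv.
  by rewrite gee0_abs// lee_fin subr_ge0 ltW// gD.
have mf : measurable_fun D (EFin \o f).
  apply: (measurable_funS measurable_sphere); first exact: subDsetl.
  exact: measurable_int If.
have [N [mN N0 DN]] := (ae_eq_integral_abs (sphere_measure R d) mD mf).1 fD.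
have : sphere_measure R d (@sphere R d) = 0%E.
  apply: (@subset_measure0 _ _ _ _ _ (N `|` [set` s])).
  - exact: measurable_sphere.
  - by apply: measurableU => //; exact: measurable_seq.
  - move=> x Sx; case: (boolP (x \in s)) => [xs|xs]; [by right|left].
    have Dx : D x by split=> //; exact/negP.
    apply: DN => /(_ Dx) /= [] /eqP; rewrite subr_eq0 => /eqP gm.
    by have := gD x Dx; rewrite gm ltxx.
  - by rewrite [LHS](measureU0 mN (measurable_seq s) s0).
by move/eqP; rewrite sphere_measure_sphere// onee_eq0.
Qed.

(** * The greedy construction *)

(** A single point of [S^0] has positive measure, so only when [d > 1] can
    the points of [s] be avoided. *)
Lemma exists_tensor_inner_le_mean {R : realType} {d t : nat}
    (s : seq (vec R d)) (c : tensor R d t) : (0 < d)%N ->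
  exists x, [/\ sphere x, (1 < d)%N -> x \notin s &
    \sum_(b : {ffun 'I_t -> 'I_d}) c b * tensor_power x b <=
    \sum_(b : {ffun 'I_t -> 'I_d}) c b * tensor_mean R b].
Proof.
move=> d0.
pose g (x : vec R d) := \sum_(b : {ffun 'I_t -> 'I_d}) c b * tensor_power x b.
have ig : (sphere_measure R d).-integrable (@sphere R d) (EFin \o g).
  apply: (sphere_integrable (\sum_(b : {ffun 'I_t -> 'I_d}) `|c b|)).
    apply: measurable_sum => b; apply: measurable_funM => //.
    exact: measurable_tensor_power.
  move=> x Sx; apply: le_trans (ler_norm_sum _ _ _) _.
  by apply: ler_sum => b _; rewrite normrM ler_piMr// tensor_power_le1.
pose s' := if (1 < d)%N then s else [::].
have s0 : sphere_measure R d [set` s'] = 0%E.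
  rewrite /s'; case: ifP => d1; first exact: sphere_measure_seq0.
  by rewrite set_nil measure0.
have [x [Sx xs gx]] := exists_le_sphere_mean s' g d0 ig s0.
exists x; split => //; first by move=> d1; move: xs; rewrite /s' d1.
apply: le_trans gx _; rewrite /g sphere_mean_sum// => b.
exact: integrable_tensor_power.
Qed.

(** The greedy step.  With [S] the current sum and [x] the new point, the
    new squared norm is [|S - M|^2 + 2 <S - M, x^t> + 1].  If
    [<S - M, x^t> <= <S - M, M>], this is at most [|S|^2 - |M|^2 + 1], so each
    step costs at most [1]. *)
Lemma exists_balanced_points {R : realType} {d : nat} (t : nat) (k : nat) :
  (0 < d)%N ->
  exists s : seq (vec R d), [/\ size s = k,
    forall x, x \in s -> sphere x,
    (1 < d)%N -> uniq s &
    \sum_(b : {ffun 'I_t -> 'I_d})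
      (\sum_(x <- s) (tensor_power x b - tensor_mean R b)) ^+ 2 <= k%:R].
Proof.
move=> d0; elim: k => [|k [s [sk sS su sb]]].
  exists [::]; split => //.
  by rewrite big1// => b _; rewrite big_nil expr0n.
pose S (b : {ffun 'I_t -> 'I_d}) :=
  \sum_(x <- s) (tensor_power x b - tensor_mean R b).
have [x [Sx xs xle]] := exists_tensor_inner_le_mean s
  (fun b => S b - tensor_mean R b) d0.
exists (x :: s); split.
- by rewrite /= sk.
- by move=> y; rewrite inE => /predU1P[->|/sS].
- by move=> d1 /=; rewrite xs// su.
have step (b : {ffun 'I_t -> 'I_d}) :
    (\sum_(y <- x :: s) (tensor_power y b - tensor_mean R b)) ^+ 2 =
    tensor_power x b ^+ 2 + ((S b - tensor_mean R b) ^+ 2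
    + 2 * ((S b - tensor_mean R b) * tensor_power x b)).
  by rewrite big_cons -/(S b); ring.
under eq_bigr do rewrite step.
rewrite !big_split /= -mulr_sumr sphere_sum_tensor_power_sqr// -[k.+1]add1n natrD.
rewrite lerD2l; apply: le_trans sb.
apply: (@le_trans _ _ (
    \sum_(b : {ffun 'I_t -> 'I_d}) (S b - tensor_mean R b) ^+ 2
    + 2 * \sum_(b : {ffun 'I_t -> 'I_d})
            (S b - tensor_mean R b) * tensor_mean R b)).
  by rewrite lerD2l ler_pM2l.
rewrite mulr_sumr -big_split; apply: ler_sum => b _ /=.
rewrite -subr_ge0 -/(S b) (_ : _ - _ = tensor_mean R b ^+ 2) ?sqr_ge0//.
ring.
Qed.

(** Weighting each point by its multiplicity in [s] turns an average over a
    list with repetitions into one over a finite set. *)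
Lemma count_weight_sum {R : realType} {T : choiceType} (s : seq T) (F : T -> R) :
  \sum_(x <- [fset y in s]%fset) (count_mem x s)%:R / (size s)%:R * F x =
  (size s)%:R^-1 * \sum_(x <- s) F x.
Proof.
have pu : perm_eq [fset y in s]%fset (undup s).
  apply: uniq_perm; rewrite ?undup_uniq ?fset_uniq// => x.
  by rewrite mem_undup !inE.
rewrite (perm_big _ pu) /= mulr_sumr -[RHS]big_undup_iterop_count /=.
apply: eq_bigr => x _; rewrite Monoid.iteropE /=.
by rewrite iter_addr_0 -[RHS]mulr_natl mulrA.
Qed.

Lemma exists_design {R : realType} {d : nat} (t N : nat) (eps : R) :
  (0 < d)%N -> (0 < N)%N -> 0 < eps -> eps ^- 2 <= N%:R ->
  exists (X : {fset vec R d}) (w : vec R d -> R),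
    [/\ approx_tensor_design t eps X w,
        (#|` X| <= N)%N & (1 < d)%N -> #|` X| = N].
Proof.
move=> d0 N0 eps0 epsN.
have [s [sN sS su sb]] := @exists_balanced_points R d t N d0.
have NR : (0 : R) < N%:R by rewrite ltr0n.
exists [fset x in s]%fset, (fun x => (count_mem x s)%:R / (size s)%:R).
split; last 2 first.
- by rewrite card_fseq -sN size_undup.
- by move=> d1; rewrite card_fseq undup_id// su.
split; first split.
- by move=> x; rewrite inE => /sS.
- move=> x; rewrite inE => xs; rewrite divr_gt0 ?sN// ltr0n.
  by rewrite -has_count has_pred1.
- under eq_bigr do rewrite -[_ / _]mulr1.
  rewrite count_weight_sum big_const_seq count_predT iter_addr_0.
  by rewrite sN mulVf// gt_eqF.
rewrite /l2norm -[leRHS]gtr0_norm// -sqrtr_sqr ler_wsqrtr//.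
apply: (@le_trans _ _ (N%:R^-1)); last by rewrite invf_ple ?posrE// exprn_gt0.
rewrite (eq_bigr (fun b : {ffun 'I_t -> 'I_d} => (N%:R^-1 ^+ 2) *
  (\sum_(x <- s) (tensor_power x b - tensor_mean R b)) ^+ 2)).
  rewrite -mulr_sumr expr2 -mulrA; apply: ler_piMr; first by rewrite invr_ge0 ltW.
  by rewrite ler_pdivrMl// mulr1.
move=> b _; rewrite -exprMn; congr (_ ^+ 2).
rewrite /tensor_moment count_weight_sum sN big_split /= mulrDr; congr (_ + _).
rewrite big_const_seq count_predT iter_addr_0 sN -[X in _ * X]mulr_natl.
by rewrite mulKf// gt_eqF.
Qed.

Theorem theorem5 (R : realType) (t : nat) (eps : R)
    (t_gt0 : (0 < t)%N) (eps_gt0 : 0 < eps) :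
  (forall d : nat, (0 < d)%N ->
     exists (X : {fset vec R d}) (w : vec R d -> R),
       [/\ approx_tensor_design t eps X w,
           (#|` X|)%:Z <= Num.ceil (eps ^- 2) &
           (1 < d)%N -> (#|` X|)%:Z = Num.ceil (eps ^- 2)])
  /\
  (~~ odd t ->
   exists delta : nat -> R,
     delta @ \oo --> (0 : R) /\
     forall (d : nat) (X : {fset vec R d}) (w : vec R d -> R),
       (0 < d)%N -> approx_tensor_design t eps X w ->
       eps ^- 2 - delta d <= (#|` X|)%:R).
Proof.
split.
  move=> d d0.
  have e0 : 0 < eps ^- 2 by rewrite invr_gt0 exprn_gt0.
  have c0 : 0 < Num.ceil (eps ^- 2) by rewrite ceil_gt0.
  have cE : (`|Num.ceil (eps ^- 2)|%N)%:Z = Num.ceil (eps ^- 2).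
    by rewrite gez0_abs// ltW.
  have [||X [w [Xw XN XE]]] :=
      @exists_design R d t `|Num.ceil (eps ^- 2)|%N eps d0 _ eps_gt0.
  - by rewrite absz_gt0 gt_eqF.
  - by rewrite pmulrn cE ceil_ge.
  by exists X, w; split => //; [rewrite -cE lez_nat|move=> /XE ->].
(* the deficit left by the bound of design_card_ge *)
move=> t2; exists (fun d => eps ^- 2 - (eps ^+ 2 + 2 / d%:R)^-1); split.
  rewrite -[X in _ --> X](subrr (eps ^- 2)).
  apply: cvgB; first exact: cvg_cst.
  apply: cvgV; first by rewrite expf_neq0// gt_eqF.
  rewrite -[X in _ --> X]addr0; apply: cvgD; first exact: cvg_cst.
  rewrite -[X in _ --> X](mulr0 2); apply: cvgMl_tmp.
  by rewrite -cvg_shiftS; exact: cvg_harmonic.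
move=> d X w d0 Xw; rewrite opprB addrC subrK.
exact: (design_card_ge eps X w d0 t_gt0 t2 eps_gt0 Xw).
Qed.
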